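(* Let $\psi_n \in k[x]$ be the $n$-th Cantor division polynomial of $(X,o)$ and let $\alpha \in k$ be a root of $f$. Then $\frac{1}{n^2}\log|\psi_n^2(\alpha)| \to \frac{1}{2}\log|f'(\alpha)|$ as $n \to \infty$, where only integers $n$ are taken with $p \nmid (n-g+1)\cdots(n+g-1)$. Moreover, as $n \to \infty$ through integers $n$ with $p \nmid (n-g+1)\cdots(n+g-1)$, we have $\frac{1}{n^2}\log|\mathrm{Res}(f,\psi_n^2)| \to \frac{1}{2}\log|\Delta|$, where $\Delta$ is the discriminant of $f$.
   Context: Let $g \geq 1$ be an integer and let $k$ be a field of characteristic $p$ where $p=0$ or $p \geq 2g+1$. Let $|\cdot|$ be an absolute value on $k$. Let $(X,o)$ be an elliptic curve or a pointed hyperelliptic curve of genus $g \geq 2$ over $k$, given by an equation $y^2 = f(x)$ with $f(x) \in k[x]$ monic, separable and of degree $2g+1$, with $o$ the point at infinity. Cantor's division polynomial $\psi_n$ (for $n \geq g$) is defined as a Hankel determinant in the polynomials $P_j(x)$, where $S(z) = \sum_j P_j(x)(2y)^{1-2j}z^j$ is the power series satisfying $S(z)^2 = f(x-z)$, $S(0)=(-1)^{g+1}y$. *)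

(* Defs.v *)
From HB Require Import structures.
From mathcomp Require Import all_boot all_order all_algebra all_field.
From mathcomp Require Import all_classical all_reals all_analysis.
From mathcomp Require Import ring.

Set Implicit Arguments.
Unset Strict Implicit.
Unset Printing Implicit Defensive.

Import Order.TTheory GRing.Theory Num.Theory.

Local Open Scope ring_scope.

(* The characteristic of k is p, where p = 0 is allowed. *)
Definition has_char (k : fieldType) (p : nat) : Prop :=
  (p = 0%N /\ [pchar k] =i pred0) \/ p \in [pchar k].

Record is_absolute_value (R : realType) (k : fieldType) (v : k -> R) : Prop :=
  IsAbsoluteValue {
    absv_ge0 : forall x, 0 <= v x;
    absv_eq0 : forall x, v x = 0 <-> x = 0;
    absvM : forall x y, v (x * y) = v x * v y;
    absvD : forall x y, v (x + y) <= v x + v y }.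

(* Res(f, f^`()) up to the usual sign, for monic f.  MathComp writes the rows
   of the Sylvester matrix in increasing degrees, so that its [resultant p q]
   is the classical Res(q, p); this sign matters when f^`() has odd degree,
   which happens in positive characteristic. *)
Definition discriminant (k : fieldType) (f : {poly k}) : k :=
  (-1) ^+ 'C((size f).-1, 2) * resultant f^`() f.

(* K is a field containing k[x] (through iota) together with a square root y
   of f(x), such as the function field of y^2 = f(x).
   The power series S(z) = \sum_j P_j(x) (2y)^(1 - 2j) z^j of K[[z]] is given
   by its sequence of coefficients; S(z)^2 = f(x - z) is stated coefficient by
   coefficient, with a Cauchy product on the left. *)
Definition cantor_coef (k K : fieldType) (iota : {rmorphism {poly k} -> K})
    (y : K) (P : nat -> {poly k}) (j : nat) : K :=
  iota (P j) * (2 * y) ^ (1 - (2 * j)%N%:Z).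

Definition f_x_minus_z (k K : fieldType) (iota : {rmorphism {poly k} -> K})
    (f : {poly k}) : {poly K} :=
  map_poly (iota \o polyC) f \Po ((iota 'X)%:P - 'X).

Definition is_cantor_series (g : nat) (k K : fieldType) (f : {poly k})
    (iota : {rmorphism {poly k} -> K}) (y : K) (P : nat -> {poly k}) : Prop :=
  let s := cantor_coef iota y P in
  s 0%N = (-1) ^+ g.+1 * y /\
  forall m : nat,
    \sum_(i < m.+1) s i * s (m - i)%N = (f_x_minus_z iota f)`_m.

(* For n >= g, with m = floor ((n - g) / 2), this is the m x m Hankel
   determinant with top left entry P_(g+1) if n = g mod 2 and P_(g+2)
   otherwise; the bottom right entry is P_(n-1) in both cases, and
   psi_g = psi_(g+1) = 1. *)
Definition cantor_psi (g : nat) (k : fieldType) (P : nat -> {poly k}) (n : nat)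
    : {poly k} :=
  let m := (n - g)./2 in
  \det (\matrix_(i < m, j < m) P (g.+1 + odd (n - g) + i + j)%N).

(* The integers n >= g such that p does not divide (n-g+1)...(n+g-1); for
   p = 0 this is all of them. *)
Definition cantor_indices (g p : nat) : set nat :=
  [set n | (g <= n)%N /\
           ~~ (p %| \prod_((n - g).+1 <= j < n + g) j)%N].

(* The data (K, iota, y, P) used above exist for every f != 0 in characteristic
   different from 2. *)
Lemma function_field_exists (k : fieldType) (f : {poly k}) :
  exists (K : fieldType) (iota : {rmorphism {poly k} -> K}) (y : K),
    injective iota /\ y ^+ 2 = iota f.
Proof.
pose F : fieldType := {fraction {poly k}}.
pose tF : {rmorphism {poly k} -> F} := @tofrac {poly k}.
have tFI : injective tF by move=> a b /eqP; rewrite tofrac_eq => /eqP.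
have [[y y2]|nsq] := EM (exists y : F, y ^+ 2 = tF f); first by exists F, tF, y.
pose q : {poly F} := 'X^2 - (tF f)%:P.
have szq : size q = 3 by rewrite size_XnsubC.
have qirr : irreducible_poly q.
  apply: cubic_irreducible; first by rewrite szq.
  move=> x; apply/negP; rewrite rootE !hornerE subr_eq0 => /eqP x2.
  by apply: nsq; exists x.
have [L _ [z + _]] := irredp_FAdjoin qirr.
rewrite rmorphB /= map_polyXn map_polyC rootE !hornerE subr_eq0 => /eqP z2.
exists L, (in_alg L \o tF : {rmorphism _ -> _}), z; split=> //.
by apply: inj_comp => //; exact: fmorph_inj.
Qed.

Lemma f_x_minus_zE (k K : fieldType) (iota : {rmorphism {poly k} -> K}) f :
  f_x_minus_z iota f = map_poly iota (map_poly polyC f \Po ('X%:P - 'X)).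
Proof.
by rewrite map_comp_poly rmorphB /= map_polyX map_polyC /= -map_poly_comp.
Qed.

Lemma is_cantor_series_exists (g : nat) (k K : fieldType) (f : {poly k})
    (iota : {rmorphism {poly k} -> K}) (y : K) :
  f != 0 -> (2 : k) != 0 -> y ^+ 2 = iota f -> injective iota ->
  exists P, is_cantor_series g f iota y P.
Proof.
move=> f0 two0 y2 iotaI.
pose c := map_poly polyC f \Po ('X%:P - 'X).
have c0 : c`_0 = f.
  by rewrite -horner_coef0 horner_comp hornerD hornerN hornerC hornerX subr0; exact: comp_polyXr.
pose F (Q : nat -> {poly k}) m : {poly k} :=
  if m == 0%N then (-1) ^+ g.+1 * (2^-1)%:P else
  (-1) ^+ g.+1 * (c`_m * (4 * f) ^+ m.-1 - \sum_(1 <= i < m) Q i * Q (m - i)%N).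
pose fix L n : seq {poly k} :=
  if n is n'.+1 then rcons (L n') (F (nth 0 (L n')) n') else [::].
pose P n := nth 0 (L n.+1) n.
have szL n : size (L n) = n by elim: n => //= n IH; rewrite size_rcons IH.
have LP n i : (i < n)%N -> nth 0 (L n) i = P i.
  elim: n => // n IH; rewrite ltnS leq_eqVlt => /predU1P[-> //|lt_in].
  by rewrite /= nth_rcons szL lt_in IH.
have PE m : P m = F P m.
  rewrite {1}/P /= nth_rcons szL ltnn eqxx /F; case: eqP => // _.
  congr (_ * (_ - _)); apply: eq_big_nat => i /andP[i0 im].
  by rewrite !LP// ltn_subrL i0 (leq_ltn_trans _ im).
have two0K : (2 : K) != 0.
  have -> : (2 : K) = iota (2%:P) by rewrite polyCMn rmorphMn /= !rmorph1.
  by rewrite -(rmorph0 iota) (inj_eq iotaI) polyC_eq0.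
have y0 : y != 0 by rewrite -sqrf_eq0 y2 -(rmorph0 iota) (inj_eq iotaI).
have u0 : 2 * y != 0 by rewrite mulf_neq0.
have sgn : ((-1) ^+ g.+1 : K) * (-1) ^+ g.+1 = 1 by rewrite -expr2 sqrr_sign.
pose s := cantor_coef iota y P.
have s0 : s 0%N = (-1) ^+ g.+1 * y.
  rewrite /s /cantor_coef PE /F eqxx muln0 subr0 expr1z rmorphM rmorph_sign.
  rewrite -mulrA; congr (_ * _).
  have -> : iota (2^-1)%:P = 2^-1.
    apply: (mulfI two0K); rewrite divff//.
    have {1}-> : (2 : K) = iota (2%:P) by rewrite polyCMn rmorphMn /= !rmorph1.
    by rewrite -rmorphM -polyCM divff// !rmorph1.
  by rewrite mulrA mulVf// mul1r.
exists P; split=> // m; rewrite f_x_minus_zE coef_map -/c -/s.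
case: m => [|m]; first by rewrite big_ord1 s0 c0 mulrACA sgn mul1r -expr2 y2.
rewrite -(big_mkord xpredT (fun i => s i * s (m.+1 - i)%N)).
rewrite big_nat_recl// big_nat_recr//= subn0 subnn [s m.+1 * _]mulrC.
have sE i j : (i + j = m.+1)%N ->
    s i * s j = iota (P i * P j) * ((2 * y) ^+ (2 * m))^-1.
  move=> ij; rewrite /s /cantor_coef mulrACA -rmorphM -expfzDr//; congr (_ * _).
  rewrite exprnN; congr (_ ^ _).
  have -> : j = (m.+1 - i)%N by rewrite -ij addKn.
  have le : (i <= m.+1)%N by rewrite -ij leq_addr.
  rewrite !PoszM -subzn// -addn1 PoszD; ring.
rewrite sE ?add0n//.
under eq_big_nat => i /andP[_ im] do rewrite sE ?addSn ?subSS ?subnKC 1?ltnW//.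
rewrite -mulr_suml -!mulrDl -rmorph_sum -!rmorphD.
have P00 : P 0%N *+ 2 = (-1) ^+ g.+1.
  rewrite PE /F eqxx -mulrnAr -polyCMn.
  by rewrite -(mulr_natr 2^-1) mulVf// mulr1.
have -> : P 0%N * P m.+1 + (\sum_(0 <= i < m) P i.+1 * P (m - i)%N
    + P 0%N * P m.+1) = c`_m.+1 * (4 * f) ^+ m.
  rewrite addrCA -mulr2n -mulrnAl P00 PE /F /= mulrA -expr2 sqrr_sign mul1r.
  by rewrite big_add1 /= addrC subrK.
have -> : (2 * y) ^+ (2 * m) = iota ((4 * f) ^+ m).
  by rewrite exprM [(2 * y) ^+ 2]exprMn y2 rmorphXn rmorphM rmorphMn rmorph1 -natrX.
rewrite rmorphM mulfK// -(rmorph0 iota) (inj_eq iotaI) expf_neq0// mulf_neq0//.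
have -> : (4 : {poly k}) = (2 * 2)%:P by rewrite -natrM polyCMn.
by rewrite polyC_eq0 mulf_neq0.
Qed.

(* Main.v *)
Require Import Defs.
From HB Require Import structures.
From mathcomp Require Import all_boot all_order all_fingroup all_algebra all_field.
From mathcomp Require Import all_classical all_reals all_analysis.
From mathcomp Require Import ring zify lra.

Set Implicit Arguments.
Unset Strict Implicit.
Unset Printing Implicit Defensive.

Import Order.TTheory GRing.Theory Num.Theory.
Local Open Scope classical_set_scope.
Local Open Scope ring_scope.

(* Modulo f the defining equation becomes T(z)^2 = 1/4 - f' z for
   T(z) = \sum_j P_j z^j, so P_(j+1) = (-1)^g C_j f'^(j+1) mod f with C_j the
   Catalan numbers.  Hence psi_n = +- D_n f'^N mod f, where
   4 N = n^2 - r^2 with r = g or g + 1, and D_n is the determinant of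
   (C_(r+i+j)) for 0 <= i, j < m, 2 m = n - r.  It satisfies
     D_n * \prod_(0 < i <= s < r) (i + s) = \prod_(0 < i <= s < r) (i + s + 2 m),
   a product of a bounded number of integers which are nonzero in k under the
   condition on n.  An absolute value satisfies |ln |j|| <= B j on the integers
   j that are nonzero in k, so ln |D_n| = O(n) = o(n^2), and both limits are
   read off, the resultant of f with a polynomial q being, up to sign, the norm
   of q from k[x]/(f) to k. *)

(** * Catalan numbers and their Hankel determinants *)

Definition catalan (n : nat) : nat := ('C(2 * n, n) - 'C(2 * n, n.+1))%N.

Lemma mul_catalan n : (n.+1 * catalan n = 'C(2 * n, n))%N.
Proof.
have -> : ('C(2 * n, n) = n.+1 * 'C(2 * n, n) - n * 'C(2 * n, n))%N by nia.
by rewrite mulnBr mul_bin_left; congr (_ - _ * _)%N; lia.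
Qed.

Lemma catalan_gt0 n : (0 < catalan n)%N.
Proof.
have : (0 < 'C(2 * n, n))%N by rewrite bin_gt0 leq_pmull.
by rewrite -mul_catalan muln_gt0.
Qed.

Lemma bin_central_sym n : 'C((2 * n).+1, n) = 'C((2 * n).+1, n.+1).
Proof. by rewrite -[RHS]bin_sub ?ltnS ?leq_pmull//; congr binomial; lia. Qed.

Lemma catalanS n : (n.+2 * catalan n.+1 = 2 * (2 * n + 1) * catalan n)%N.
Proof.
apply/eqP; rewrite -(eqn_pmul2l (ltn0Sn n)) mul_catalan; apply/eqP.
have h1 := mul_bin_diag (2 * n.+1) n.
have h2 := mul_bin_diag (2 * n).+1 n.
have h4 := mul_catalan n.
move: h1; have -> : ((2 * n.+1).-1 = (2 * n).+1)%N by lia.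
by rewrite bin_central_sym; move: h2; rewrite /= -h4; nia.
Qed.

(* These are the coefficients t_n of sqrt(1 - 4 z), characterised by
   (1 - 4 z) t' = - 2 t; their convolution square w satisfies
   (1 - 4 z) w' = - 4 w, as 1 - 4 z does. *)
Definition sqrt_coef (n : nat) : int := if n is n'.+1 then - (2 * catalan n')%:R else 1.

Lemma sqrt_coefS n : n.+1%:R * sqrt_coef n.+1 = (4 * n%:R - 2) * sqrt_coef n.
Proof.
case: n => [//|n] /=.
have := congr1 (fun i : nat => i%:R : int) (catalanS n).
by rewrite !natrM !natrD; nia.
Qed.

Lemma sqrt_coef_conv n : \sum_(i < n.+3) sqrt_coef i * sqrt_coef (n.+2 - i)%N = 0.
Proof.
pose w m : int := \sum_(i < m.+1) sqrt_coef i * sqrt_coef (m - i)%N.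
have wD m : m%:R * w m =
    2 * \sum_(i < m.+1) i%:R * (sqrt_coef i * sqrt_coef (m - i)%N).
  have sym : \sum_(i < m.+1) (m - i)%:R * (sqrt_coef i * sqrt_coef (m - i)%N) =
      \sum_(i < m.+1) i%:R * (sqrt_coef i * sqrt_coef (m - i)%N).
    rewrite (reindex_inj rev_ord_inj) /=; apply: eq_bigr => i _.
    by rewrite subSS subKn -1?ltnS// [sqrt_coef i * _]mulrC.
  rewrite [RHS]mulr_natl mulr2n -{1}sym -big_split mulr_sumr /=.
  apply: eq_bigr => i _; rewrite -mulrDl -natrD subnK// -ltnS; exact: ltn_ord.
have wS m : m.+1%:R * w m.+1 = (4 * m%:R - 4) * w m.
  rewrite wD big_ord_recl mul0r add0r.
  under eq_bigr => i _ do rewrite lift0 subSS mulrA sqrt_coefS -mulrA.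
  under eq_bigr => i _ do rewrite mulrBl -mulrA.
  rewrite sumrB -!mulr_sumr mulrBr mulrCA -wD mulrBl mulrA.
  by rewrite -/(w m); ring.
have w2 : w 2%N = 0 by rewrite /w !big_ord_recr big_ord0.
suff : w n.+2 = 0 by [].
elim: n => [//|n IH]; have := wS n.+2; rewrite IH mulr0 => /eqP.
by rewrite mulf_eq0 => /orP[|/eqP //]; rewrite pnatr_eq0.
Qed.

Lemma catalan_conv n :
  (\sum_(i < n.+1) catalan i * catalan (n - i) = catalan n.+1)%N.
Proof.
apply/eqP; rewrite -(eqr_nat int) natr_sum; apply/eqP.
have := sqrt_coef_conv n; rewrite big_ord_recl big_ord_recr /=.
rewrite add0n /bump !add1n subnn /= mul1r mulr1.
under eq_bigr => i _.
  rewrite !add0n add1n !subSS subSn -1?ltnS ?ltn_ord//=.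
  rewrite mulrNN !natrM mulrACA; over.
rewrite -mulr_sumr natrM; under [in X in _ -> X]eq_bigr do rewrite natrM.
by set S := \sum_(i < _) _; lia.
Qed.

Lemma det_scale_rc (R : comPzRingType) m (u w : 'I_m -> R) (A : 'M[R]_m) :
  \det (\matrix_(i, j) (u i * A i j * w j)) =
  (\prod_i u i) * \det A * \prod_j w j.
Proof.
have -> : \matrix_(i, j) (u i * A i j * w j) =
    diag_mx (\row_i u i) *m A *m diag_mx (\row_i w i).
  by apply/matrixP=> i j; rewrite mul_mx_diag mul_diag_mx !mxE.
rewrite !det_mulmx !det_diag; congr (_ * _ * _);
  by apply: eq_bigr => i _; rewrite mxE.
Qed.

Definition hankel_catalan (r m : nat) : int :=
  \det (\matrix_(i < m, j < m) (catalan (r + i + j))%:R).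

(* The ballot numbers; they satisfy b(n+1,k) = b(n,k-1) + 2 b(n,k) + b(n,k+1),
   with b(n,-1) = 0, and this tridiagonal recurrence is self-adjoint. *)
Definition ballot (n k : nat) : int :=
  'C((2 * n).+1, (n + k).+1)%:R - 'C((2 * n).+1, (n + k).+2)%:R.

Lemma ballot_small n k : (n < k)%N -> ballot n k = 0.
Proof. by move=> nk; rewrite /ballot !bin_small ?subrr//; lia. Qed.

Lemma ballot_diag n : ballot n n = 1.
Proof. by rewrite /ballot addnn -mul2n binn bin_small// subr0. Qed.

Lemma ballotS n k : ballot n.+1 k.+1 =
  ballot n k + 2 * ballot n k.+1 + ballot n k.+2.
Proof.
rewrite /ballot !addnS !addSn.
have -> : ((2 * n.+1).+1 = (2 * n).+3)%N by lia.
by move: (2 * n).+1 => N; rewrite !binS !natrD; ring.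
Qed.

Lemma ballotS0 n : ballot n.+1 0 = 2 * ballot n 0 + ballot n 1.
Proof.
rewrite /ballot !addn0 addn1.
have -> : ((2 * n.+1).+1 = (2 * n).+3)%N by lia.
by move: (bin_central_sym n); move: (2 * n).+1 => N sym; rewrite !binS sym !natrD; ring.
Qed.

Lemma ballot0 n : ballot n 0 = (catalan n.+1)%:R.
Proof.
have le : ('C(2 * n.+1, n.+2) <= 'C(2 * n.+1, n.+1))%N.
  rewrite -(leq_pmul2l (ltn0Sn n.+1)) mul_bin_left.
  by rewrite leq_mul//; lia.
rewrite /catalan natrB// /ballot addn0.
have -> : (2 * n.+1 = (2 * n).+2)%N by lia.
by move: (bin_central_sym n); move: (2 * n).+1 => N sym; rewrite !binS sym !natrD; ring.
Qed.

Lemma ballot_adjoint N i j : (i < N)%N -> (j < N)%N ->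
  \sum_(k < N) ballot i.+1 k * ballot j k =
  \sum_(k < N) ballot i k * ballot j.+1 k.
Proof.
case: N => // N iN jN.
have recl M (F : nat -> int) : \sum_(k < M.+1) F k = F 0%N + \sum_(k < M) F k.+1.
  by rewrite big_ord_recl; congr (_ + _); apply: eq_bigr => k _; rewrite lift0.
have E a b : (a <= N)%N ->
    \sum_(k < N.+1) ballot a.+1 k * ballot b k =
    \sum_(k < N) (ballot a k * ballot b k.+1 + ballot a k.+1 * ballot b k)
    + 2 * \sum_(k < N.+1) ballot a k * ballot b k.
  move=> aN; rewrite (recl _ (fun k => ballot a.+1 k * ballot b k)) ballotS0
    (recl _ (fun k => ballot a k * ballot b k)) big_split /=.
  have -> : \sum_(k < N) ballot a.+1 k.+1 * ballot b k.+1 =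
      \sum_(k < N) ballot a k * ballot b k.+1 +
      2 * \sum_(k < N) ballot a k.+1 * ballot b k.+1 +
      \sum_(k < N) ballot a k.+2 * ballot b k.+1.
    rewrite mulr_sumr -!big_split /=; apply: eq_bigr => k _.
    by rewrite ballotS; ring.
  have -> : \sum_(k < N) ballot a k.+2 * ballot b k.+1 =
      \sum_(k < N) ballot a k.+1 * ballot b k - ballot a 1 * ballot b 0.
    have z : ballot a N.+1 = 0 by rewrite ballot_small.
    case: N {aN iN jN} z => [|M] z; first by rewrite !big_ord0 z mul0r subr0.
    rewrite big_ord_recr /= z mul0r addr0 (recl _ (fun k => ballot a k.+1 * ballot b k)).
    ring.
  ring.
rewrite E//; under [in RHS]eq_bigr do rewrite mulrC.
rewrite E//; congr (_ + 2 * _); last by apply: eq_bigr => k _; rewrite mulrC.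
by apply: eq_bigr => k _; ring.
Qed.

Lemma ballot_sum i j N : (i + j < N)%N ->
  \sum_(k < N) ballot i k * ballot j k = (catalan (i + j).+1)%:R.
Proof.
elim: i j => [|i IH] j lt; last first.
  by rewrite ballot_adjoint ?IH ?addSnnS//; lia.
case: N lt => // N _; rewrite big_ord_recl big1 => [|k _]; last first.
  by rewrite lift0 ballot_small// mul0r.
by rewrite addr0 ballot_diag mul1r ballot0.
Qed.

Lemma hankel_catalan1 m : hankel_catalan 1 m = 1.
Proof.
pose B : 'M[int]_m := \matrix_(i, j) ballot i j.
have -> : hankel_catalan 1 m = \det (B *m B^T).
  congr (\det _); apply/matrixP=> i j; rewrite !mxE !add1n addSn.
  rewrite -(@ballot_sum i j (m + m)); last by have := ltn_ord i; have := ltn_ord j; lia.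
  rewrite big_split_ord /= [X in _ + X]big1 ?addr0 => [|k _]; last first.
    by rewrite ballot_small ?mul0r//; have := ltn_ord i; lia.
  by apply: eq_bigr => k _; rewrite !mxE.
rewrite det_mulmx det_tr det_trig ?big1 ?mulr1// => [i _|].
  by rewrite mxE ballot_diag.
by apply/is_trig_mxP => i j lt; rewrite mxE ballot_small.
Qed.

Lemma catalan_prod n j :
  (catalan (n + j) * \prod_(l < j) (n + l + 2) =
   catalan n * \prod_(l < j) (2 * (2 * (n + l) + 1)))%N.
Proof.
elim: j => [|j IH]; first by rewrite !big_ord0 addn0.
rewrite !big_ord_recr /= [in RHS]mulnA -IH addnS.
by rewrite mulnCA [(catalan _ * _)%N]mulnC addn2 catalanS; ring.
Qed.

(* Row i of the matrix of the C_(r+i+j) is proportional to the values at r + i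
   of the polynomials [rowp m j], which do not depend on r; the determinant of
   these values is a translation invariant Vandermonde times a constant. *)
Definition rowp (m j : nat) : {poly int} := \prod_(l < m.-1)
  (if (l < j)%N then 4 *: 'X + (4 * l + 2)%:R%:P else 'X + (l + 2)%:R%:P).

Lemma size_rowp m j : (0 < m)%N -> (size (rowp m j) <= m)%N.
Proof.
move=> m0; apply: leq_trans (size_prod_leq _ _) _.
set F := BIG_F.
have : ( \sum_(i < m.-1) F i <= \sum_(i < m.-1) 2)%N.
  apply: leq_sum => i _; rewrite /F; case: ifP => _.
    apply: leq_trans (size_polyD _ _) _; rewrite geq_max (leq_trans (size_polyC_leq1 _))//.
    by rewrite (leq_trans (size_scale_leq _ _))// size_polyX.
  by rewrite size_XaddC.
by rewrite sum_nat_const !card_ord leq_subLR => /leq_ltn_trans; apply; lia.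
Qed.

Lemma rowpE m (j : 'I_m) n :
  (catalan (n + j))%:R * \prod_(l < m.-1) (n + l + 2)%:R =
  (catalan n)%:R * (rowp m j).[n%:R] :> int.
Proof.
have jm : (j <= m.-1)%N by case: m j => [[]|] // m j; rewrite -ltnS.
have -> : (rowp m j).[n%:R] =
    (\prod_(l < j) (2 * (2 * (n + l) + 1)) * \prod_(j <= l < m.-1) (n + l + 2))%N%:R.
  rewrite /rowp horner_prod.
  rewrite -(big_mkord xpredT (fun l => (if (l < j)%N then 4 *: 'X + (4 * l + 2)%:R%:P
    else 'X + (l + 2)%:R%:P).[n%:R])) (big_cat_nat _ jm)//=.
  rewrite natrM !natr_prod -(big_mkord xpredT (fun l => (2 * (2 * (n + l) + 1))%N%:R)).
  congr (_ * _).
    apply: eq_big_nat => l /andP[_ ->]; rewrite !hornerE; lia.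
  apply: eq_big_nat => l /andP[jl _]; rewrite ltnNge jl /= !hornerE; lia.
rewrite -natr_prod -!natrM; congr (_%:R).
rewrite -(big_mkord xpredT (fun l => n + l + 2)%N) (big_cat_nat _ jm)//=.
by rewrite big_mkord !mulnA catalan_prod.
Qed.

Lemma det_rowp_shift m r :
  \det (\matrix_(i < m, j < m) (rowp m j).[(r + i)%:R]) =
  \det (\matrix_(i < m, j < m) (rowp m j).[i%:R]).
Proof.
case: m => [|m]; first by rewrite !det_mx00.
pose C : 'M[int]_m.+1 := \matrix_(i, j) (rowp m.+1 j)`_i.
have E s : \matrix_(i < m.+1, j < m.+1) (rowp m.+1 j).[(s + i)%:R] =
    (Vandermonde m.+1 (\row_i (s + i)%:R))^T *m C.
  apply/matrixP=> i j; rewrite !mxE (horner_coef_wide _ (size_rowp j (ltn0Sn m))).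
  by apply: eq_bigr => l _; rewrite !mxE mulrC.
rewrite E [in RHS](E 0%N) !det_mulmx !det_tr !det_Vandermonde; congr (_ * _).
apply: eq_bigr => i _; apply: eq_bigr => j _; rewrite !mxE; lia.
Qed.

Lemma hankel_catalan_rowp r m :
  (\prod_(i < m) \prod_(l < m.-1) (r + i + l + 2)%:R) * hankel_catalan r m =
  (\prod_(i < m) (catalan (r + i))%:R) *
    \det (\matrix_(i < m, j < m) (rowp m j).[i%:R]).
Proof.
rewrite -(det_rowp_shift m r).
have := det_scale_rc (fun i : 'I_m => (catalan (r + i))%:R) (fun=> 1)
  (\matrix_(i < m, j < m) (rowp m j).[(r + i)%:R]).
rewrite big1_eq mulr1 => <-.
have := det_scale_rc (fun i : 'I_m => \prod_(l < m.-1) (r + i + l + 2)%:R) (fun=> 1)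
  (\matrix_(i < m, j < m) (catalan (r + i + j))%:R : 'M[int]_m).
rewrite big1_eq mulr1 => <-; congr (\det _); apply/matrixP => i j.
by rewrite !mxE !mulr1 mulrC rowpE.
Qed.

Lemma hankel_catalanS r m :
  (\prod_(i < m) (r + i + m + 1)%:R) * hankel_catalan r.+1 m =
  (\prod_(i < m) (2 * (2 * (r + i) + 1))%N%:R) * hankel_catalan r m.
Proof.
case: m => [|m]; first by rewrite !big_ord0 /hankel_catalan !det_mx00.
have h0 := hankel_catalan_rowp r m.+1; have h1 := hankel_catalan_rowp r.+1 m.+1.
move: h0 h1; set E := \det _.
set G := \prod_(i < m.+1) _.
have Gneq0 : G != 0.
  apply/prodf_neq0 => i _; apply/prodf_neq0 => l _.
  by rewrite pnatr_eq0 addn2.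
set K := \prod_(i < m.+1) (catalan _)%:R.
have Kneq0 : K != 0.
  by apply/prodf_neq0 => i _; rewrite pnatr_eq0 -lt0n catalan_gt0.
set G1 := \prod_(i < m.+1) _; set K1 := \prod_(i < m.+1) (catalan _)%:R.
set Q := \prod_(i < m.+1) _; set T := \prod_(i < m.+1) _.
pose W : int := \prod_(i < m.+1) (r + i + 2)%:R.
have Wneq0 : W != 0.
  by apply/prodf_neq0 => i _; rewrite pnatr_eq0 addn2.
have GW : G1 * W = G * Q.
  rewrite /G1 /G /W /Q -!big_split; apply: eq_bigr => i _ /=.
  have shift a n : (\prod_(l < n) (a.+1 + l + 2)%:R) * (a + 2)%:R =
      (\prod_(l < n) (a + l + 2)%:R) * (a + n + 2)%:R :> int.
    elim: n => [|n IH]; first by rewrite !big_ord0 addn0.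
    rewrite !big_ord_recr /= mulrAC IH -!mulrA.
    by congr (_ * (_%:R * _%:R)); lia.
  by rewrite (shift (r + i)%N m); congr (_ * _%:R); lia.
have KW : K1 * W = K * T.
  rewrite /K1 /K /W /T -!big_split; apply: eq_bigr => i _ /=.
  rewrite -!natrM addSn; congr (_%:R); have := catalanS (r + i); nia.
move=> h0 h1; apply: (mulfI (mulf_neq0 Gneq0 (mulf_neq0 Kneq0 Wneq0))).
transitivity (K * W * (G1 * W * hankel_catalan r.+1 m.+1)).
  by rewrite GW; ring.
rewrite [_ * W * hankel_catalan _ _]mulrAC h1.
transitivity (K * W * (K1 * W * E)); first ring.
rewrite KW; transitivity (T * K * W * (K * E)); first ring.
by rewrite -h0; ring.
Qed.

Lemma hankel_ratio r m :
  (\prod_(i < m) (2 * (2 * (r + i) + 1)) * \prod_(i < r) (i.+1 + r) =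
   \prod_(i < m) (r + i + m + 1) * \prod_(i < r) (i.+1 + r + 2 * m))%N.
Proof.
have rise a n : (a`! * \prod_(i < n) (i.+1 + a) = (n + a)`!)%N.
  elim: n => [|n IH]; first by rewrite big_ord0 muln1.
  by rewrite big_ord_recr /= mulnA IH addSn factS mulnC.
have odds : (\prod_(i < m) (2 * (2 * (r + i) + 1)) * (r + r)`! * (r + m)`! =
    r`! * (r + m + (r + m))`!)%N.
  elim: m => [|m IH]; first by rewrite big_ord0 mul1n !addn0 mulnC.
  rewrite big_ord_recr /=.
  have -> : (r + m.+1 + (r + m.+1) = (r + m + (r + m)).+2)%N by lia.
  rewrite (addnS r m) !factS; move: IH.
  set A := \prod_(i < m) _; set a := (r + r)`!; set b := r`!; set c := (r + m)`!;
  set d := (r + m + _)`! => IH.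
  transitivity ((2 * (2 * (r + m) + 1) * (r + m).+1) * (A * a * c))%N; first ring.
  by rewrite IH; ring.
have rf := rise r r; have rm := rise (r + m)%N m; have rr := rise (r + 2 * m)%N r.
have E1 : (\prod_(i < m) (r + i + m + 1) = \prod_(i < m) (i.+1 + (r + m)))%N.
  by apply: eq_bigr => i _; lia.
have E2 : (\prod_(i < r) (i.+1 + r + 2 * m) = \prod_(i < r) (i.+1 + (r + 2 * m)))%N.
  by apply: eq_bigr => i _; lia.
rewrite E1 E2.
have e1 : (m + (r + m) = r + 2 * m)%N by lia.
have e2 : (r + (r + 2 * m) = r + m + (r + m))%N by lia.
rewrite e1 in rm; rewrite e2 in rr.
apply/eqP; rewrite -(eqn_pmul2l (fact_gt0 (r + m))) -(eqn_pmul2l (fact_gt0 r)).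
apply/eqP.
transitivity (\prod_(i < m) (2 * (2 * (r + i) + 1)) *
  (r`! * \prod_(i < r) (i.+1 + r)) * (r + m)`!)%N; first by ring.
by rewrite rf odds -rr -rm; ring.
Qed.

Lemma hankel_catalanE r m :
  (\prod_(s < r.+1) \prod_(i < s) (i.+1 + s)%:R) * hankel_catalan r.+1 m =
  \prod_(s < r.+1) \prod_(i < s) (i.+1 + s + 2 * m)%:R.
Proof.
elim: r => [|r IH]; first by rewrite !big_ord_recl !big_ord0 hankel_catalan1 !mulr1.
have Pneq0 : (\prod_(i < m) (r.+1 + i + m + 1)%:R : int) != 0.
  by apply/prodf_neq0 => i _; rewrite pnatr_eq0 addn1.
rewrite big_ord_recr [RHS]big_ord_recr /= -IH; apply: (mulfI Pneq0).
have := hankel_catalanS r.+1 m.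
have := congr1 (fun i : nat => i%:R : int) (hankel_ratio r.+1 m).
rewrite !natrM !natr_prod.
set a := \prod_(i < m) _; set b := \prod_(i < r.+1) _.
set c := \prod_(i < m) _; set d := \prod_(i < r.+1) _ => e1 e2.
transitivity (b * d * (a * hankel_catalan r.+2 m)); first by ring.
rewrite e2; transitivity (b * hankel_catalan r.+1 m * (c * d)); first by ring.
by rewrite e1; ring.
Qed.

(** * Resultants with a monic polynomial as norms *)

Lemma resultantC (R : comNzRingType) (p q : {poly R}) :
  exists b : bool, resultant p q = (-1) ^+ b * resultant q p.
Proof.
rewrite /resultant; set dp := (size p).-1; set dq := (size q).-1.
pose e : (dp + dq = dq + dp)%N := addnC dp dq.
pose swap T1 T2 (x : T1 + T2) := match x with inl a => inr a | inr b => inl b end.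
pose s (i : 'I_(dq + dp)) : 'I_(dq + dp) :=
  cast_ord e (unsplit (swap _ _ (fintype.split i))).
have s_inj : injective s.
  move=> i j /cast_ord_inj /(can_inj unsplitK) eij.
  by apply: (can_inj splitK); case: (fintype.split i) (fintype.split j) eij => a [] b // [->].
have dcast n n' (E : n = n') (A : 'M[R]_n) : \det (castmx (E, E) A) = \det A.
  by case: n' / E; rewrite castmx_id.
have -> : Sylvester_mx p q = row_perm (perm s_inj) (castmx (e, e) (Sylvester_mx q p)).
  apply/matrixP => i j; rewrite [RHS]mxE permE castmxE !Sylvester_mxE cast_ordK unsplitK /=.
  by case: (fintype.split i).
by rewrite row_permE det_mulmx det_perm dcast; eexists.
Qed.

Section NormModulo.
Variables (k : fieldType) (f : {poly k}).
Let d := (size f).-1.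

(* Multiplication by q on k[x]/(f), acting on the right in the basis x^i. *)
Definition modmul_mx (q : {poly k}) : 'M[k]_d :=
  \matrix_(i < d) poly_rV (('X^i * q) %% f).

Definition modnorm (q : {poly k}) : k := \det (modmul_mx q).

Hypothesis f_monic : f \is monic.
Let f0 : f != 0 := monic_neq0 f_monic.

Lemma size_modp_monic q : (size (q %% f)%R <= d)%N.
Proof. by rewrite -ltnS prednK ?ltn_modp// size_poly_gt0. Qed.

Lemma mul_rV_modmul (u : 'rV_d) q :
  u *m modmul_mx q = poly_rV ((rVpoly u * q) %% f).
Proof.
rewrite mulmx_sum_row [rVpoly u]poly_def mulr_suml.
rewrite (big_morph (fun p => p %% f) (modpD f) (mod0p f)) linear_sum /=.
apply: eq_bigr => i _; rewrite rowK valK -scalerAl modpZl linearZ /=.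
by [].
Qed.

Lemma modnormM q r : modnorm (q * r) = modnorm q * modnorm r.
Proof.
rewrite /modnorm -det_mulmx; congr (\det _); apply/row_matrixP => i.
rewrite row_mul mul_rV_modmul !rowK poly_rV_K ?size_modp_monic//.
by rewrite mulrA [in RHS]mulrC modp_mul [r * _]mulrC.
Qed.

Lemma eq_modnorm q r : f %| q - r -> modnorm q = modnorm r.
Proof.
move=> fqr; congr (\det _); apply/row_matrixP => i; rewrite !rowK; congr (poly_rV _).
apply/eqP; rewrite -subr_eq0 -modpN -modpD -mulrBr -/(dvdp _ _).
by rewrite dvdp_mull.
Qed.

Lemma modnormC c : modnorm c%:P = c ^+ d.
Proof.
rewrite /modnorm -[d in RHS]card_ord -prodr_const.
rewrite (_ : modmul_mx _ = c%:M) ?det_scalar ?prodr_const ?card_ord//.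
apply/matrixP => i j; rewrite !mxE mulrC mul_polyC modpZl modp_small; last first.
  by rewrite size_polyXn (leq_ltn_trans (ltn_ord i))// prednK ?size_poly_gt0.
by rewrite coefZ coefXn mulr_natr eq_sym.
Qed.

Lemma modnormX q n : modnorm (q ^+ n) = modnorm q ^+ n.
Proof.
elim: n => [|n IH]; first by rewrite !expr0 (modnormC 1) expr1n.
by rewrite !exprS modnormM IH.
Qed.

Lemma resultant_modnorm q : resultant q f = modnorm q.
Proof.
rewrite /resultant /Sylvester_mx -/d; set dq := (size q).-1.
pose band n (r : {poly k}) : 'M[k]_(n, d + dq) := lin1_mx (poly_rV \o r \o* rVpoly).
pose Q : 'M[k]_(d, dq) := \matrix_(i < d) poly_rV (('X^i * q) %/ f).
have rband n r i : row i (band n r) = poly_rV ('X^i * r).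
  by rewrite rowE mul_rV_lin1 /= rVpoly_delta.
have eband n r (i : 'I_n) j : band n r i j = ('X^i * r)`_j.
  by move/rowP: (rband n r i) => /(_ j); rewrite mxE => ->; rewrite mxE.
have rmband n r (u : 'rV_n) : u *m band n r = poly_rV (rVpoly u * r).
  by rewrite mul_rV_lin1.
have -> : col_mx (band d q) (band dq f) =
    block_mx (modmul_mx q) Q 0 1%:M *m col_mx (band d 1) (band dq f).
  rewrite mul_block_col mul0mx mul1mx add0r; congr col_mx.
  apply/row_matrixP => i; rewrite linearD /= !row_mul !rowK !rmband rband.
  rewrite !poly_rV_K ?size_modp_monic//.
    by rewrite -linearD /= mulr1 addrC -divp_eq.
  have [->|q0] := eqVneq q 0; first by rewrite mulr0 div0p size_poly0.
  rewrite size_divp// mulrC size_mulXn//; rewrite -/d /dq.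
  have := ltn_ord i; have : (0 < size q)%N by rewrite size_poly_gt0.
  move: (size q) (nat_of_ord i) => s t; lia.
rewrite det_mulmx det_ublock det1 mulr1 (_ : \det (col_mx _ _) = 1) ?mulr1//.
have lf : f`_d = 1 by apply/eqP.
rewrite det_trig.
  apply: big1 => i _; rewrite mxE; case: splitP => j ij; rewrite eband.
    by rewrite mulr1 coefXn ij eqxx.
  by rewrite coefXnM ij ltnNge leq_addl /= addnK.
apply/is_trig_mxP => i l il; rewrite mxE; case: splitP => j ij; rewrite eband.
  by rewrite mulr1 coefXn; case: eqP => //; move: il; rewrite ij; lia.
rewrite coefXnM; case: ltnP => // jl; apply: nth_default.
by apply: leq_trans (leqSpred _) _; rewrite ltn_subRL addnC -ij.
Qed.

End NormModulo.

(** * Cantor's division polynomials modulo f *)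

Section PolyCongruence.
Variables (k : fieldType) (f : {poly k}).

Definition eqmodp (u v : {poly k}) : bool := f %| u - v.

Lemma eqmodp_refl u : eqmodp u u.
Proof. by rewrite /eqmodp subrr dvdp0. Qed.

Lemma eqmodp_sym u v : eqmodp u v -> eqmodp v u.
Proof. by rewrite /eqmodp -dvdpNr opprB. Qed.

Lemma eqmodp_trans v u w : eqmodp u v -> eqmodp v w -> eqmodp u w.
Proof. by move=> h1 h2; rewrite /eqmodp -(subrKA v) dvdp_add. Qed.

Lemma eqmodpD u v u' v' : eqmodp u v -> eqmodp u' v' -> eqmodp (u + u') (v + v').
Proof. by move=> h1 h2; rewrite /eqmodp opprD addrACA dvdp_add. Qed.

Lemma eqmodpM u v u' v' : eqmodp u v -> eqmodp u' v' -> eqmodp (u * u') (v * v').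
Proof.
move=> h1 h2; rewrite /eqmodp.
have -> : u * u' - v * v' = (u - v) * u' + v * (u' - v') by ring.
by apply: dvdp_add; [exact: dvdp_mulr|exact: dvdp_mull].
Qed.

Lemma eqmodpMl w u v : eqmodp u v -> eqmodp (w * u) (w * v).
Proof. exact/eqmodpM/eqmodp_refl. Qed.

Lemma eqmodp_sum (I : Type) (r : seq I) (Q : pred I) (F G : I -> {poly k}) :
  (forall i, Q i -> eqmodp (F i) (G i)) ->
  eqmodp (\sum_(i <- r | Q i) F i) (\sum_(i <- r | Q i) G i).
Proof.
by move=> FG; apply: (big_ind2 eqmodp) => // [|*]; [exact: eqmodp_refl|exact: eqmodpD].
Qed.

Lemma eqmodp_prod (I : Type) (r : seq I) (Q : pred I) (F G : I -> {poly k}) :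
  (forall i, Q i -> eqmodp (F i) (G i)) ->
  eqmodp (\prod_(i <- r | Q i) F i) (\prod_(i <- r | Q i) G i).
Proof.
by move=> FG; apply: (big_ind2 eqmodp) => // [|*]; [exact: eqmodp_refl|exact: eqmodpM].
Qed.

Lemma eqmodp_det m (A B : 'M[{poly k}]_m) :
  (forall i j, eqmodp (A i j) (B i j)) -> eqmodp (\det A) (\det B).
Proof.
move=> AB; apply: eqmodp_sum => s _; apply: eqmodpMl.
by apply: eqmodp_prod => i _; exact: AB.
Qed.

End PolyCongruence.

Section CantorModulo.
Variables (g : nat) (k K : fieldType) (f : {poly k}).
Variables (iota : {rmorphism {poly k} -> K}) (y : K) (P : nat -> {poly k}).
Hypotheses (f0 : f != 0) (two0 : (2 : k) != 0).
Hypotheses (y2 : y ^+ 2 = iota f) (iotaI : injective iota).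
Hypothesis cantorP : is_cantor_series g f iota y P.

Let c := map_poly polyC f \Po ('X%:P - 'X).

Let y0 : y != 0.
Proof. by rewrite -sqrf_eq0 y2 -(rmorph0 iota) (inj_eq iotaI). Qed.

Let two_iota : (2 : K) = iota 2%:P.
Proof. by rewrite polyCMn rmorphMn /= !rmorph1. Qed.

Let u0 : 2 * y != 0.
Proof.
by rewrite mulf_neq0// two_iota -(rmorph0 iota) (inj_eq iotaI) polyC_eq0.
Qed.

Lemma cantor0 : 2 * P 0%N = (-1) ^+ g.+1.
Proof.
have [+ _] := cantorP; rewrite /cantor_coef muln0 subr0 expr1z => s0.
apply: iotaI; rewrite rmorphM rmorph_sign rmorphMn rmorph1.
by apply: (mulIf y0); rewrite -s0; ring.
Qed.

Lemma cantor_conv m :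
  \sum_(i < m.+2) P i * P (m.+1 - i)%N = c`_m.+1 * (4 * f) ^+ m.
Proof.
have [_ /(_ m.+1)] := cantorP; rewrite f_x_minus_zE coef_map -/c /= => H.
have u2 : (2 * y) ^+ (2 * m) = iota ((4 * f) ^+ m).
  by rewrite exprM [(2 * y) ^+ 2]exprMn y2 rmorphXn rmorphM rmorphMn rmorph1 -natrX.
apply: iotaI; rewrite rmorphM -u2 -H mulr_suml rmorph_sum /=.
apply: eq_bigr => i _; rewrite /cantor_coef rmorphM mulrACA -expfzDr//.
rewrite -!mulrA exprnP -expfzDr// (_ : _ + _ = 0) ?expr0z ?mulr1//.
have := ltn_ord i; lia.
Qed.

Lemma cantor_coef1 : c`_1 = - f^`().
Proof.
have -> : c`_1 = (c^`())`_0 by rewrite coef_deriv.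
rewrite /c deriv_comp derivB derivC derivX sub0r mulrN1 coefN deriv_map.
rewrite -horner_coef0 horner_comp hornerD hornerN hornerC hornerX subr0.
by congr (- _); exact: comp_polyXr.
Qed.

Lemma cantor_modf j :
  eqmodp f (P j.+1) ((-1) ^+ g * (catalan j)%:R * f^`() ^+ j.+1).
Proof.
have conv m : eqmodp f (\sum_(i < m.+3) P i * P (m.+2 - i)%N) 0.
  by rewrite cantor_conv exprS /eqmodp subr0 dvdp_mull// dvdp_mulr// dvdp_mull.
have P0 Q : 2 * P 0%N * Q = - ((-1) ^+ g * Q).
  by rewrite cantor0 exprS; ring.
have sgK (Q : {poly k}) : (-1) ^+ g * ((-1) ^+ g * Q) = Q.
  by rewrite mulrA -expr2 sqrr_sign mul1r.
have ends m : \sum_(i < m.+3) P i * P (m.+2 - i)%N =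
    - ((-1) ^+ g * P m.+2) + \sum_(i < m.+1) P i.+1 * P (m.+1 - i)%N.
  rewrite big_ord_recl big_ord_recr /= subn0 -P0 /bump !add1n subnn.
  under eq_bigr => i _ do rewrite add1n subSS.
  ring.
elim/ltn_ind: j => -[_|j IH].
  have : 2 * P 0%N * P 1%N = - f^`().
    rewrite -cantor_coef1 -[RHS]mulr1 -(expr0 (4 * f)) -cantor_conv.
    by rewrite !big_ord_recl big_ord0 /= subn0 subnn; ring.
  rewrite P0.
  move=> /oppr_inj /(congr1 ( *%R ((-1) ^+ g))); rewrite sgK => ->.
  by rewrite mulr1 expr1 eqmodp_refl.
have := conv j; rewrite ends => /eqmodp_sym /(eqmodpMl ((-1) ^+ g)).
rewrite mulr0 mulrDr mulrN sgK => E.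
have {}E : eqmodp f (P j.+2) ((-1) ^+ g * \sum_(i < j.+1) P i.+1 * P (j.+1 - i)%N).
  by move: E; rewrite /eqmodp sub0r opprD opprK.
apply: (eqmodp_trans E); rewrite -mulrA; apply: eqmodpMl.
rewrite -catalan_conv natr_sum mulr_suml; apply: eqmodp_sum => i _.
have ij : (i <= j)%N by rewrite -ltnS.
rewrite subSn//; apply: eqmodp_trans (eqmodpM (IH i _) (IH (j - i)%N _)) _.
- by rewrite ltnS.
- by rewrite ltnS leq_subr.
have -> : f^`() ^+ j.+2 = f^`() ^+ i.+1 * f^`() ^+ (j - i).+1.
  by rewrite -exprD; congr (_ ^+ _); lia.
rewrite natrM; set a := (catalan i)%:R; set b := (catalan _)%:R; set s := (-1) ^+ g.
set F := _ ^+ i.+1; set G := _ ^+ _.+1.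
have -> : s * a * F * (s * b * G) = s * (s * (a * b * (F * G))) by ring.
by rewrite /s sgK eqmodp_refl.
Qed.

Lemma cantor_psi_modf n (r := (g + odd (n - g))%N) (m := (n - g)./2) : (1 <= g)%N ->
  eqmodp f (cantor_psi g P n)
    (((-1) ^+ (g * m) * (hankel_catalan r m)%:~R)%:P * f^`() ^+ (m * (r + m))).
Proof.
move=> g1; rewrite /cantor_psi -/m.
pose h : {rmorphism int -> {poly k}} := intr.
pose A : 'M[{poly k}]_m := map_mx h (\matrix_(i, j) (catalan (r + i + j))%:R).
pose u (i : 'I_m) : {poly k} := (-1) ^+ g * f^`() ^+ (r.+1 + i).
pose w (i : 'I_m) : {poly k} := f^`() ^+ i.
apply: (@eqmodp_trans _ _ (\det (\matrix_(i, j) (u i * A i j * w j)))).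
  apply: eqmodp_det => i j; rewrite !mxE.
  have -> : (g.+1 + odd (n - g) + i + j)%N = (r + i + j).+1 by rewrite /r; lia.
  apply: eqmodp_trans (cantor_modf _) _.
  have -> : (-1) ^+ g * (catalan (r + i + j))%:R * f^`() ^+ (r + i + j).+1 =
      u i * (catalan (r + i + j))%:R * w j by rewrite /u /w -!addSn exprD; ring.
  by rewrite rmorph_nat eqmodp_refl.
rewrite det_scale_rc big_split /= prodr_const card_ord -exprM /A det_map_mx.
rewrite -/(hankel_catalan r m) /w -!expr_sum.
have -> : ((-1) ^+ (g * m) * (hankel_catalan r m)%:~R)%:P =
    (-1) ^+ (g * m) * h (hankel_catalan r m).
  by rewrite polyCM rmorphXn rmorphN1 /= rmorph_int.
have -> : (m * (r + m) = \sum_(i < m) (r.+1 + i) + \sum_(i < m) i)%N.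
  rewrite -big_split /=; elim: (m) => [|l IH]; first by rewrite big_ord0.
  by rewrite big_ord_recr /= -IH; lia.
rewrite exprD.
set e := _ ^+ (g * m); set H := h _.
set F := _ ^+ (\sum_(i < m) (_ + _)); set G := _ ^+ (\sum_(i < m) i).
have -> : e * F * H * G = e * H * (F * G) by ring.
exact: eqmodp_refl.
Qed.

End CantorModulo.

(** * Absolute values of integers *)

Section AbsoluteValue.
Variables (R : realType) (k : fieldType) (v : k -> R).
Hypothesis vP : is_absolute_value v.

Lemma absv_gt0 x : x != 0 -> 0 < v x.
Proof.
move=> x0; rewrite lt_neqAle (absv_ge0 vP) andbT eq_sym.
by apply: contraNneq x0 => /(absv_eq0 vP) ->.
Qed.

Lemma absv1 : v 1 = 1.
Proof.
have v1 : v 1 != 0 by rewrite gt_eqF// absv_gt0 ?oner_neq0.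
by apply: (mulfI v1); rewrite -(absvM vP) !mulr1.
Qed.

Lemma absvX x n : v (x ^+ n) = v x ^+ n.
Proof. by elim: n => [|n IH]; rewrite ?absv1// !exprS (absvM vP) IH. Qed.

Lemma absvN x : v (- x) = v x.
Proof.
have vN1 : v (-1) = 1.
  apply/eqP; rewrite -(@eqrXn2 _ 2)// ?(absv_ge0 vP)//.
  by rewrite -absvX sqrrN expr1n absv1 expr1n.
by rewrite -mulN1r (absvM vP) vN1 mul1r.
Qed.

Lemma absv_sign n : v ((-1) ^+ n) = 1.
Proof. by rewrite absvX absvN absv1 expr1n. Qed.

Lemma absv_nat_le n : v n%:R <= n%:R.
Proof.
elim: n => [|n IH]; first by rewrite ((absv_eq0 vP 0).2 erefl).
by rewrite !mulrSr (le_trans (absvD vP _ _))// lerD// absv1.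
Qed.

Lemma exists_expr_lt (c e : R) : 0 <= c < 1 -> 0 < e -> exists n, c ^+ n < e.
Proof.
move=> /andP[c0 c1] e0.
have /cvgrPdist_lt/(_ e e0)[N _ /(_ N (leqnn N))] : (fun n => c ^+ n) @ \oo --> 0.
  by apply: cvg_expr; rewrite ger0_norm.
by rewrite /= sub0r normrN normrX (ger0_norm c0) => ?; exists N.
Qed.

Lemma absv_nat_le1 q n : (1 < q)%N -> v q%:R < 1 -> v n%:R <= 1.
Proof.
move=> q1 vq; have c0 := absv_ge0 vP q%:R.
pose B : R := q%:R / (1 - v q%:R).
have d0 : 0 < 1 - v q%:R by rewrite subr_gt0.
have B0 : 0 < B by rewrite divr_gt0// ltr0n ltnW.
have BE : B * v q%:R + q%:R = B by rewrite /B; field; rewrite gt_eqF.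
have bnd m : v m%:R <= B.
  elim/ltn_ind: m => m IH; case: (posnP m) => [->|m0].
    by rewrite ((absv_eq0 vP 0).2 erefl) ltW.
  rewrite {1}(divn_eq m q) natrD natrM (le_trans (absvD vP _ _))//.
  rewrite (absvM vP) -[leRHS]BE lerD// ?ler_wpM2r ?IH ?ltn_Pdiv//.
  by rewrite (le_trans (absv_nat_le _))// ler_nat ltnW// ltn_mod ltnW.
rewrite leNgt; apply/negP => vn.
have vn0 : 0 < v n%:R by rewrite (lt_trans _ vn).
have [||j] := @exists_expr_lt (v n%:R)^-1 B^-1; rewrite ?invr_gt0//.
  by rewrite invr_ge0 ltW//= invf_lt1.
by rewrite exprVn ltf_pV2 ?posrE ?exprn_gt0// -absvX -natrX ltNge bnd.
Qed.

Lemma absv_nat_coprime p m : (1 < p)%N -> v p%:R < 1 -> coprime p m -> 1 <= v m%:R.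
Proof.
move=> p1 vp cop; have le1 n := absv_nat_le1 n p1 vp.
rewrite leNgt; apply/negP => vm.
pose c := Num.max (v p%:R) (v m%:R).
have c0 : 0 <= c by rewrite le_max (absv_ge0 vP).
have [||j cj] := @exists_expr_lt c 2^-1; rewrite ?invr_gt0 ?c0 ?gt_max ?vp//.
have pj : (0 < p ^ j)%N by rewrite expn_gt0 ltnW.
have := coprimeXl j (coprimeXr j cop); rewrite /coprime => /eqP copj.
case: (egcdnP (m ^ j) pj) => a b E _; rewrite copj in E.
have : (1 : k) = a%:R * p%:R ^+ j - b%:R * m%:R ^+ j.
  by rewrite -!natrX -!natrM E natrD addrAC subrr add0r.
move=> /(congr1 v); rewrite absv1 => v1.
have le_c x n : v x <= c -> v n%:R * v x ^+ j <= c ^+ j.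
  move=> xc; rewrite -[leRHS]mul1r ler_pM ?exprn_ge0 ?(absv_ge0 vP)//.
  by rewrite lerXn2r ?nnegrE ?(absv_ge0 vP).
have : v (a%:R * p%:R ^+ j - b%:R * m%:R ^+ j) <= c ^+ j + c ^+ j.
  rewrite (le_trans (absvD vP _ _))// absvN !(absvM vP) !absvX.
  by rewrite lerD// le_c// le_max lexx ?orbT.
by rewrite -v1; lra.
Qed.

Lemma absv_nat_ge1 : (forall p, prime p -> 1 <= v p%:R) ->
  forall n, (0 < n)%N -> 1 <= v n%:R.
Proof.
move=> vp; elim/ltn_ind => n IH n0; have [n1|n1] := leqP n 1.
  by rewrite (_ : n = 1)%N ?absv1//; lia.
rewrite -(divnK (pdiv_dvd n)) natrM (absvM vP).
apply: mulr_ege1; last by rewrite vp// pdiv_prime.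
by rewrite IH ?ltn_Pdiv ?prime_gt1 ?pdiv_prime// divn_gt0 ?pdiv_gt0 ?pdiv_leq.
Qed.

Lemma ln_absv_nat : exists2 C : R, 0 <= C &
  forall n, n%:R != 0 :> k -> `|ln (v n%:R)| <= C * n%:R.
Proof.
have [[p pp vp]|nex] := EM (exists2 p, prime p & v p%:R < 1); last first.
  exists 1 => // n n0; rewrite mul1r.
  have {}n0 : (0 < n)%N by case: n n0 => //; rewrite eqxx.
  have vn : 1 <= v n%:R.
    apply: absv_nat_ge1 => // q qp; rewrite leNgt; apply/negP => ?.
    by apply: nex; exists q.
  rewrite ger0_norm ?ln_ge0// (le_trans _ (absv_nat_le n))//.
  by rewrite ltW// ln_sublinear// (lt_le_trans _ vn).
exists `|ln (v p%:R)| => // n nk.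
have n0 : (0 < n)%N by case: n nk => //; rewrite eqxx.
have [m cop nE] := pfactor_coprime pp n0; set l := logn p n in nE.
have vn1 := absv_nat_le1 n (prime_gt1 pp) vp.
have vm1 := absv_nat_coprime (prime_gt1 pp) vp cop.
have lenl : (l <= n)%N.
  rewrite nE (leq_trans (ltnW (ltn_expl l (prime_gt1 pp))))// leq_pmull//.
  by case: (m) nE n0 => // ->.
have [l0|l0] := posnP l.
  rewrite (_ : v n%:R = 1) ?ln1 ?normr0 ?mulr_ge0//.
  by apply/eqP; rewrite eq_le vn1/= nE l0 muln1.
have vp0 : 0 < v p%:R.
  apply: absv_gt0; apply: contraNneq nk => p0.
  by rewrite nE natrM natrX p0 expr0n gtn_eqF// mulr0.
have vpl : v p%:R ^+ l <= v n%:R.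
  by rewrite [n]nE natrM natrX (absvM vP) absvX ler_peMl ?exprn_ge0 ?(ltW vp0).
rewrite ler0_norm ?ln_le0// (@le_trans _ _ (`|ln (v p%:R)| * l%:R))//; last first.
  by rewrite ler_wpM2l ?ler_nat.
rewrite (@ler0_norm _ (ln (v p%:R))) ?ln_le0 ?(ltW vp)// mulNr lerN2 mulr_natr -lnXn//.
by rewrite ler_ln ?posrE ?exprn_gt0 ?(absv_gt0 nk).
Qed.

Lemma ln_absv_prod n (F : 'I_n -> k) (B : R) :
  (forall i, F i != 0 /\ `|ln (v (F i))| <= B) ->
  \prod_i F i != 0 /\ `|ln (v (\prod_i F i))| <= n%:R * B.
Proof.
elim: n F => [|n IH] F FB; first by rewrite big_ord0 oner_neq0 absv1 ln1 normr0 mul0r.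
rewrite big_ord_recr /=.
have [p0 pB] := IH (fun i => F (widen_ord (leqnSn n) i)) (fun i => FB _).
have [f0 fB] := FB ord_max.
rewrite mulf_neq0// (absvM vP) lnM ?posrE ?absv_gt0//; split=> //.
by rewrite (le_trans (ler_normD _ _))// mulrSr mulrDl mul1r lerD.
Qed.

End AbsoluteValue.

Lemma natr_char_eq0 (k : fieldType) p n : has_char k p -> (n%:R == 0 :> k) = (p %| n)%N.
Proof.
move=> [[-> /pcharf0P ->]|pk]; first by rewrite dvd0n.
by rewrite (dvdn_pcharf pk).
Qed.

Lemma ln_absv_hankel (R : realType) (k : fieldType) (v : k -> R) g p :
  is_absolute_value v -> has_char k p -> p = 0%N \/ (2 * g + 1 <= p)%N -> (1 <= g)%N ->
  exists C : R, forall n, cantor_indices g p n ->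
    let h : k := (hankel_catalan (g + odd (n - g)) (n - g)./2)%:~R in
    h != 0 /\ `|ln (v h)| <= C * n%:R.
Proof.
move=> vP kp pg g1; have [C C0 vC] := ln_absv_nat vP.
exists (2 * (g.+1%:R * (g.+1%:R * (C * 2)))) => n [gn pn].
set e := odd (n - g); set m := (n - g)./2.
have nE : (n = g + e + 2 * m)%N.
  by have := odd_double_half (n - g); rewrite -/e -/m; lia.
have e1 : (e <= 1)%N by rewrite /e; case: odd.
have [r rE] : exists r, (g + e)%N = r.+1 by exists (g + e).-1; rewrite prednK//; lia.
rewrite rE; move: (hankel_catalanE r m) => /(congr1 (intr : int -> k)).
pose prods (c : nat) : k := \prod_(s < r.+1) \prod_(i < s) (i.+1 + s + c)%:R.
have bound c : (forall s i, (i < s)%N -> (s < r.+1)%N -> ~~ (p %| i.+1 + s + c)%N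
    /\ (i.+1 + s + c <= 2 * n)%N) ->
    prods c != 0 /\ `|ln (v (prods c))| <= g.+1%:R * (g.+1%:R * (C * 2)) * n%:R.
  move=> H; have CB0 : 0 <= C * (2 * n)%:R by rewrite mulr_ge0.
  have [|nz le] := @ln_absv_prod _ _ _ vP r.+1 (fun s => \prod_(i < s) (i.+1 + s + c)%:R)
      (r.+1%:R * (C * (2 * n)%:R)).
    move=> s.
    have [|nz le] := @ln_absv_prod _ _ _ vP s (fun i => (i.+1 + s + c)%:R) (C * (2 * n)%:R).
      move=> i; have [Hp Hn] := H s i (ltn_ord i) (ltn_ord s).
      have nz : (i.+1 + s + c)%:R != 0 :> k by rewrite (natr_char_eq0 _ kp).
      split=> //; apply: (le_trans (vC _ nz)).
      by rewrite ler_wpM2l// ler_nat.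
    split=> //; apply: (le_trans le); rewrite ler_wpM2r// ler_nat.
    exact/ltnW/ltn_ord.
  split=> //; apply: (le_trans le).
  rewrite -!mulrA -natrM ler_pM ?mulr_ge0// ?ler_nat; first by lia.
  by rewrite ler_wpM2r// ler_nat; lia.
have [A0 lA] : prods 0%N != 0 /\ `|ln (v (prods 0%N))| <= g.+1%:R * (g.+1%:R * (C * 2)) * n%:R.
  apply: bound => s i si sr; rewrite addn0; split; last by lia.
  case: pg => [->|pg]; first by rewrite dvd0n.
  by apply/negP => /dvdn_leq; lia.
have [B0 lB] : prods (2 * m)%N != 0 /\
    `|ln (v (prods (2 * m)%N))| <= g.+1%:R * (g.+1%:R * (C * 2)) * n%:R.
  apply: bound => s i si sr; split; last by lia.
  apply: contra pn => /dvdn_trans; apply.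
  rewrite (bigD1_seq (i.+1 + s + 2 * m)%N) ?iota_uniq//= ?dvdn_mulr//.
  by rewrite mem_index_iota; lia.
set h : k := (hankel_catalan _ _)%:~R.
have prodsE c : (\prod_(s < r.+1) \prod_(i < s) (i.+1 + s + c)%:R)%:~R = prods c.
  rewrite rmorph_prod; apply: eq_bigr => s _; rewrite rmorph_prod.
  by apply: eq_bigr => i _; rewrite rmorph_nat.
rewrite rmorphM /= prodsE.
have -> : (\prod_(s < r.+1) \prod_(i < s) (i.+1 + s)%:R)%:~R = prods 0%N.
  rewrite -prodsE; congr (_%:~R); apply: eq_bigr => s _.
  by apply: eq_bigr => i _; rewrite addn0.
rewrite -/h => E.
have h0 : h != 0 by apply: contraNneq B0 => h0; rewrite -E h0 mulr0.
split=> //; move: lA lB; rewrite -E (absvM vP) lnM ?posrE ?absv_gt0//.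
rewrite -[X in _ -> _ -> _ <= X]mulrA.
set a := ln _; set b := ln _; set X := _ * n%:R; rewrite !ler_norml.
by move=> /andP[? ?] /andP[? ?]; apply/andP; split; lra.
Qed.

Lemma cvg_within_scaled_lne (R : realType) (D : set nat) (w : nat -> R) (l C : R) :
  (forall n, D n -> 0 < w n) ->
  (forall n, D n -> `|ln (w n) - n%:R ^+ 2 * l| <= C * n%:R) ->
  (((n%:R ^+ 2)^-1)%:E * lne (w n)%:E)%E @[n --> within D \oo] --> l%:E.
Proof.
move=> w0 wl.
have E : \forall n \near within D \oo,
    ((n%:R ^+ 2)^-1 * ln (w n))%:E = (((n%:R ^+ 2)^-1)%:E * lne (w n)%:E)%E.
  by rewrite near_withinE; near=> n => Dn; rewrite /lne leNgt w0.
apply: cvg_trans (near_eq_cvg E) _; apply: cvg_EFin; first by near=> n.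
apply/cvgrPdist_le => e e0; rewrite near_withinE.
exists (Num.bound `|C / e|).+1 => // n /= nN Dn.
have n0 : 0 < n%:R :> R by rewrite ltr0n; case: n nN {Dn}.
have CE : C <= e * n%:R.
  rewrite mulrC -ler_pdivrMr// (le_trans (ler_norm _))// ltW//.
  by rewrite (lt_le_trans (archi_boundP _))// ler_nat ltnW.
rewrite -(@ler_pM2l _ (n%:R ^+ 2)) ?exprn_gt0//.
rewrite -[X in X * `|_|]ger0_norm ?exprn_ge0 ?(ltW n0)// -normrM mulrBr mulrA.
rewrite divff ?expf_neq0 ?gt_eqF// mul1r distrC (le_trans (wl n Dn))//.
by rewrite [leLHS]mulrC expr2 -mulrA ler_wpM2l ?(ltW n0)// mulrC.
Unshelve. all: by end_near.
Qed.

Lemma cvg_cantor_growth (R : realType) (k : fieldType) (v : k -> R) (g p c : nat)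
    (b : R) (w : nat -> R) :
  is_absolute_value v -> has_char k p -> p = 0%N \/ (2 * g + 1 <= p)%N -> (1 <= g)%N ->
  0 < b ->
  (forall n, let r := (g + odd (n - g))%N in let m := (n - g)./2 in
     w n = (v (hankel_catalan r m)%:~R ^+ c * b ^+ (m * (r + m))) ^+ 2) ->
  (((n%:R ^+ 2)^-1)%:E * lne (w n)%:E)%E @[n --> within (cantor_indices g p) \oo]
    --> ((2^-1 : R)%:E * lne b%:E)%E.
Proof.
move=> vP kp pg g1 b0 wE; have [C hC] := ln_absv_hankel vP kp pg g1.
rewrite [lne _]/lne leNgt b0 /= -EFinM.
apply: (cvg_within_scaled_lne (C := (c%:R * C) *+ 2 + g.+1%:R ^+ 2 * `|ln b|)) => n Dn.
  have [h0 _] := hC n Dn.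
  by rewrite wE exprn_gt0// mulr_gt0// exprn_gt0// absv_gt0.
have [h0 hle] := hC n Dn; have [gn _] := Dn.
rewrite wE; move: h0 hle; set r := (g + odd _)%N; set m := _./2; set h := v _ => h0 hle.
have vh0 : 0 < h by exact: absv_gt0.
rewrite lnXn ?mulr_gt0 ?exprn_gt0// lnM ?posrE ?exprn_gt0// !lnXn//.
have nE : (n = r + 2 * m)%N.
  by have := odd_double_half (n - g); rewrite -/m /r; lia.
have {}nE : (m * (r + m))%:R = (n%:R ^+ 2 - r%:R ^+ 2) / 4 :> R.
  by rewrite nE; clearbody r m; rewrite !natrD !natrM natrD; field.
rewrite -(mulr_natr (ln b)) nE -(mulr_natr (ln h)).
have rg : r%:R ^+ 2 <= g.+1%:R ^+ 2 :> R.
  by rewrite lerXn2r ?nnegrE// ler_nat /r; case: odd; lia.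
have n1 : 1 <= n%:R :> R by rewrite ler1n (leq_trans g1).
rewrite (_ : _ - _ = (ln h * c%:R) *+ 2 - r%:R ^+ 2 / 2 * ln b); last by field.
rewrite (le_trans (ler_normB _ _))// mulrDl lerD//.
  rewrite normrMn normrM (ger0_norm (ler0n _ c)).
  have := ler_wpM2r (ler0n R c) hle; lra.
rewrite normrM [leRHS]mulrAC ler_wpM2r// ger0_norm ?divr_ge0 ?exprn_ge0//.
have r0 : 0 <= r%:R ^+ 2 :> R by rewrite exprn_ge0.
rewrite (@le_trans _ _ (g.+1%:R ^+ 2))//; first by lra.
by rewrite ler_peMr// exprn_ge0.
Qed.

Theorem theorem1p2 (R : realType) (g p : nat) (k : fieldType)
    (absv : k -> R) (f : {poly k})
    (K : fieldType) (iota : {rmorphism {poly k} -> K}) (y : K)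
    (P : nat -> {poly k})
    (g_ge1 : (1 <= g)%N)
    (char_k : has_char k p)
    (p_cond : p = 0%N \/ (2 * g + 1 <= p)%N)
    (absvP : is_absolute_value absv)
    (f_monic : f \is monic)
    (f_sep : separable_poly f)
    (f_deg : (size f).-1 = (2 * g + 1)%N)
    (iota_inj : injective iota)
    (y_eq : y ^+ 2 = iota f)
    (P_cantor : is_cantor_series g f iota y P) :
  let psi := cantor_psi g P in
  (forall alpha : k, root f alpha ->
     (((n%:R ^+ 2)^-1)%:E * lne (absv ((psi n ^+ 2).[alpha]))%:E)%E
       @[n --> within (cantor_indices g p) \oo]
     --> ((2^-1 : R)%:E * lne (absv (f^`().[alpha]))%:E)%E)
  /\
  (((n%:R ^+ 2)^-1)%:E * lne (absv (resultant f (psi n ^+ 2)))%:E)%E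
     @[n --> within (cantor_indices g p) \oo]
   --> ((2^-1 : R)%:E * lne (absv (discriminant f))%:E)%E.
Proof.
move=> psi.
have two0 : (2 : k) != 0.
  rewrite (natr_char_eq0 _ char_k).
  by case: p_cond => [->|] //; apply: contraTN => /dvdn_leq; lia.
have cop : coprimep f f^`() by move: f_sep; rewrite separable_poly.unlock.
have psiE n := cantor_psi_modf (monic_neq0 f_monic) two0 y_eq iota_inj P_cantor n g_ge1.
split=> [alpha alpha0|].
  have fa : f^`().[alpha] != 0.
    exact: coprimep_root alpha0.
  apply: (cvg_cantor_growth (c := 1) absvP char_k p_cond g_ge1) => [|n r m].
    exact: absv_gt0.
  rewrite horner_exp (absvX absvP); congr (_ ^+ 2).
  have /dvdpP[q E] := psiE n.
  have -> : (psi n).[alpha] = ((-1) ^+ (g * m) * (hankel_catalan r m)%:~R) *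
      f^`().[alpha] ^+ (m * (r + m)).
    apply/eqP; rewrite -subr_eq0; move/(congr1 (horner^~ alpha)): E.
    rewrite hornerM (rootP alpha0) mulr0 hornerD hornerN hornerM hornerC horner_exp.
    by move=> /eqP.
  by rewrite !(absvM absvP) !(absvX absvP) absvN// absv1// expr1n mul1r expr1.
have nf : modnorm f f^`() != 0.
  rewrite -resultant_modnorm// resultant_eq0.
  by move: cop; rewrite coprimep_sym coprimep_def => /eqP ->.
have -> : absv (discriminant f) = absv (modnorm f f^`()).
  by rewrite /discriminant resultant_modnorm// (absvM absvP) absv_sign// mul1r.
apply: (cvg_cantor_growth (c := (size f).-1) absvP char_k p_cond g_ge1) => [|n r m].
  exact: absv_gt0.
have [s ->] := resultantC f (psi n ^+ 2).
rewrite (absvM absvP) absv_sign// mul1r resultant_modnorm// modnormX//.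
rewrite (absvX absvP); congr (_ ^+ 2); rewrite (eq_modnorm (psiE n)).
rewrite modnormM// modnormX// modnormC// !(absvM absvP) !(absvX absvP) (absvM absvP).
by rewrite absv_sign// mul1r.
Qed.
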